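(* Let $\alpha\in\mathbb{C}$. Then: (i) If $\alpha$ satisfies the height reducing property, then $\alpha$ is an algebraic number whose conjugates are all of modulus $1$, or all of modulus greater than $1$. (ii) If $\alpha$ is a root of unity, or an algebraic number all of whose conjugates are of modulus greater than $1$, then $\alpha$ satisfies the height reducing property.
   Context: For $F\subset\mathbb{C}$ and $\alpha\in\mathbb{C}$, $F[\alpha]=\{\sum_{j=0}^{n}\varepsilon_j\alpha^j : n\in\mathbb{N},\ (\varepsilon_0,\dots,\varepsilon_n)\in F^{n+1}\}$. A complex number $\alpha$ satisfies the height reducing property if there is a finite subset $F\subset\mathbb{Z}$ such that $\mathbb{Z}[\alpha]=F[\alpha]$. Conjugates are taken over $\mathbb{Q}$. *)

(* Defs.v *)
From mathcomp Require Import all_boot all_order all_algebra.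
From mathcomp Require Import boolp classical_sets cardinality reals.
From mathcomp Require Import complex.

Set Implicit Arguments.
Unset Strict Implicit.
Unset Printing Implicit Defensive.

Import Order.TTheory GRing.Theory Num.Theory.
Local Open Scope classical_set_scope.
Local Open Scope ring_scope.

Section HeightReducing.
Variable R : realType.
Local Notation C := R[i].

Definition integers : set C := range (fun m : int => m%:~R).

(* F[alpha]; at F = integers this is the ring Z[alpha]. *)
Definition digit_sums (F : set C) (alpha : C) : set C :=
  [set x | exists (n : nat) (eps : 'I_n.+1 -> C),
     (forall j, F (eps j)) /\ x = \sum_(j < n.+1) eps j * alpha ^+ j].

Definition height_reducing (alpha : C) : Prop :=
  exists F : set C, [/\ finite_set F, F `<=` integers &
    digit_sums integers alpha = digit_sums F alpha].

Definition algebraic_number (alpha : C) : Prop :=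
  algebraicOver (ratr : rat -> C) alpha.

Definition minimal_polynomial (alpha : C) (p : {poly rat}) : Prop :=
  [/\ p \is monic, irreducible_poly p & root (map_poly ratr p) alpha].

(* No [beta] satisfies this when [alpha] is transcendental, so a bound on all
   conjugates is only meaningful together with [algebraic_number alpha]. *)
Definition conjugate_of (alpha beta : C) : Prop :=
  exists2 p : {poly rat},
    minimal_polynomial alpha p & root (map_poly ratr p) beta.

(* [0.-unity_root] holds of every element, hence the condition on n. *)
Definition is_root_of_unity (alpha : C) : Prop :=
  exists2 n : nat, (0 < n)%N & n.-unity_root alpha.

End HeightReducing.

(* Main.v *)
(** For (i), the integers have expansions [q(alpha)] with [q] of coefficients at
most [N] in absolute value, and these expansions hold at every conjugate [beta]
too; a geometric series forces [1 <= `|beta|]. If some conjugate has modulus 1,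
its inverse is its complex conjugate, hence again a conjugate, so the minimal
polynomial is reciprocal and every conjugate has modulus 1.

For (ii) with [alpha] expanding, let [P] be an integer multiple of the minimal
polynomial. Dividing [A] by ['X] repeatedly, reducing the constant coefficient
modulo [P(0)] each time, gives [A = D + 'X^k * A' + P * Q] where [D] has digits
below [`|P(0)|]. For large [k] the degree of [A'] is less than that of [P] and
its values at the conjugates are bounded independently of [A]; as the conjugates
are distinct, inverting a Vandermonde matrix bounds the coefficients of [A']. *)
Require Import Defs.
From mathcomp Require Import all_boot all_order all_algebra.
From mathcomp Require Import boolp classical_sets cardinality reals.
From mathcomp Require Import complex.
From mathcomp Require Import separable polyorder ring zify.

Set Implicit Arguments.
Unset Strict Implicit.
Unset Printing Implicit Defensive.

Import Order.TTheory GRing.Theory Num.Theory.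
Local Open Scope ring_scope.

(** * Digit sums as values of integer polynomials with bounded coefficients *)

Local Notation zpoly p := (map_poly intr p).

Definition bounded_coefs (N : nat) (p : {poly int}) : Prop :=
  forall i, `|p`_i| <= N%:Z.

Lemma digit_sums_of_poly (R : realType) (F : set R[i]) (alpha : R[i])
    (q : {poly int}) :
  (forall i, F (q`_i)%:~R) -> digit_sums F alpha (zpoly q).[alpha].
Proof.
(* The sum runs one index past the last coefficient, so [q = 0] needs no separate case; the extra
   digit is [0]. *)
move=> Fq; exists (size q), (fun j => (q`_j)%:~R); split=> [j|]; first exact: Fq.
rewrite (@horner_coef_wide _ (size q).+1) ?(leq_trans (size_poly _ _)) //.
by apply: eq_bigr => j _; rewrite coef_map.
Qed.

Lemma poly_of_digit_sums (R : realType) (F : set R[i]) (D : set int)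
    (alpha x : R[i]) :
  D 0 -> (forall y, F y -> exists2 m, D m & y = m%:~R) ->
  digit_sums F alpha x ->
  exists2 q : {poly int}, (forall i, D q`_i) & (zpoly q).[alpha] = x.
Proof.
move=> D0 FD [n [eps [Feps ->]]].
have /fin_all_exists2[m Dm eps_m] := fun j => FD _ (Feps j).
exists (\poly_(i < n.+1) m (inord i)) => [i|].
  by rewrite coef_poly; case: ifP.
rewrite (@horner_coef_wide _ n.+1) ?(leq_trans (size_poly _ _)) ?size_poly //.
apply: eq_bigr => j _.
by rewrite coef_map coef_poly ltn_ord inord_val eps_m.
Qed.

(** A finite set of integers lies in some interval [[-N, N]], and this interval is itself a finite
    digit set, so digit sets can be replaced by a uniform coefficient bound. *)
Lemma height_reducingP (R : realType) (alpha : R[i]) :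
  height_reducing alpha <->
  exists N, forall p : {poly int},
    exists2 q : {poly int}, bounded_coefs N q & (zpoly q).[alpha] = (zpoly p).[alpha].
Proof.
split=> [[F [/finite_seqP[s defF] Fint eqF]]|[N bndN]].
  have /choice[g gP] y : exists m : int, F y -> y = m%:~R.
    by case: (pselect (F y)) => [/Fint[m _ <-]|nFy]; [exists m | exists 0].
  exists (foldr maxn 0 [seq `|g y|%N | y <- s]) => p.
  have : digit_sums F alpha (zpoly p).[alpha].
    by rewrite -eqF; apply: digit_sums_of_poly => i; exists p`_i.
  pose D := [set m : int | `|m| <= (foldr maxn 0 [seq `|g y|%N | y <- s])%:Z]%classic.
  case/(@poly_of_digit_sums _ F D) => [|y Fy|q Dq eq_q]; rewrite /D //=.
    exists (g y); last exact: gP.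
    have sy : y \in s by move: Fy; rewrite defF.
    rewrite -abszE lez_nat; elim: (s) sy => //= z s' IHs.
    by rewrite inE leq_max => /predU1P[-> | /IHs ->]; rewrite ?leqnn ?orbT.
  by exists q.
pose t := [seq k%:Z | k <- iota 0 N.+1].
pose F := [set` [seq m%:~R : R[i] | m <- t ++ map -%R t]]%classic.
have Fint : (F `<=` @integers R)%classic.
  by move=> y /= /mapP[m _ ->]; exists m.
exists F; split=> //; first exact: finite_seq.
rewrite eqEsubset; split=> x.
  case/(@poly_of_digit_sums _ _ setT) => // [y [m _ <-]|p _ <-]; first by exists m.
  have [q bq <-] := bndN p.
  apply: digit_sums_of_poly => i; apply/mapP; exists q`_i => //.
  have := bq i; rewrite -abszE lez_nat mem_cat.
  case: q`_i => k /= lek; apply/orP; [left|right].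
    by apply/mapP; exists k; rewrite // mem_iota.
  rewrite -map_comp; apply/mapP; exists k.+1; rewrite ?mem_iota // ?add1n ?ltnS.
by move=> [n [eps [Feps ->]]]; exists n, eps; split=> // j; apply: Fint.
Qed.

(** * Archimedean estimates *)

Lemma archi_norm (R : realType) (x : R[i]) : exists n : nat, `|x| <= n%:R.
Proof.
rewrite normc_def; set r := Num.sqrt _.
exists (Num.Def.archi_bound r).
by rewrite -(rmorph_nat (real_complex R)) lecR ltW // archi_boundP ?sqrtr_ge0.
Qed.

Lemma bernoulli (K : numDomainType) (t : K) (n : nat) :
  0 <= t -> 1 + n%:R * t <= (1 + t) ^+ n.
Proof.
move=> t0; elim: n => [|n IHn]; first by rewrite mul0r addr0 expr0.
rewrite exprSr (le_trans _ (ler_wpM2r _ IHn)) ?addr_ge0 //.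
have -> : (1 + n%:R * t) * (1 + t) = 1 + n.+1%:R * t + n%:R * t * t by ring.
by rewrite lerDl !mulr_ge0.
Qed.

Lemma expr_unbounded (R : realType) (beta x : R[i]) :
  1 < `|beta| -> exists k : nat, `|x| <= `|beta| ^+ k.
Proof.
move=> b1; have t0 : 0 < `|beta| - 1 by rewrite subr_gt0.
(* By Bernoulli's inequality with [t = |beta| - 1], any [n] at least [|x| / t] works. *)
have [n nP] := archi_norm (x / (`|beta| - 1)).
exists n; rewrite -[`|beta|](subrKC 1).
apply: le_trans (bernoulli _ (ltW t0)); rewrite ler_wpDl //.
by rewrite -ler_pdivrMr // -[X in _ / X]gtr0_norm // -normf_div.
Qed.

(** * Minimal polynomials and conjugates *)

(** The gcd of [p] and [q] vanishes at [alpha], so it is not a unit, and irreducibility makes it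
    associate to [p]. *)
Lemma minimal_polynomial_dvdp (R : realType) (alpha : R[i]) (p q : {poly rat}) :
  minimal_polynomial alpha p -> root (map_poly ratr q) alpha -> p %| q.
Proof.
case=> _ irr_p rp rq; set g := gcdp p q.
have rg : root (map_poly ratr g) alpha by rewrite gcdp_map root_gcd rp.
have g_sz : size g != 1.
  apply: contraL rg => /size_poly1P[c c0 ->].
  by rewrite map_polyC rootC fmorph_eq0.
by rewrite -(eqp_dvdl _ (apply_irredp irr_p g_sz (dvdp_gcdl _ _))) dvdp_gcdr.
Qed.

Lemma minimal_polynomial_root (R : realType) (alpha beta : R[i]) (q : {poly rat}) :
  conjugate_of alpha beta -> root (map_poly ratr q) alpha ->
  root (map_poly ratr q) beta.
Proof.
case=> p mp rb /(minimal_polynomial_dvdp mp).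
by rewrite -(dvdp_map (ratr : {rmorphism rat -> R[i]})) => /dvdpP[r ->]; rewrite rootM rb orbT.
Qed.

(** Take an annihilating polynomial of least size and make it monic. If it factors as [r * q], one
    factor vanishes at [alpha] and has full size by minimality, so the other is constant. *)
Lemma algebraic_minimal_polynomial (R : realType) (alpha : R[i]) :
  algebraic_number alpha -> exists p, minimal_polynomial alpha p.
Proof.
have size_arith1 a b c : a = (b + c).-1 -> (0 < b)%N -> (1 < c)%N -> (a <= b)%N -> False.
  by lia.
have size_arith2 a b c : a = (b + c).-1 -> (0 < b)%N -> (a <= c)%N -> c = a by lia.
pose P n := `[< exists p : {poly rat},
  [/\ p != 0, root (map_poly ratr p) alpha & size p = n] >].
case=> p0 nz_p0 r0; have exP : exists n, P n.
  by exists (size p0); apply/asboolP; exists p0.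
case: (ex_minnP exP) => n /asboolP[p [nz_p rp sz_p]] minP.
have {}minP (q : {poly rat}) : q != 0 -> root (map_poly ratr q) alpha -> (n <= size q)%N.
  by move=> nzq rq; apply: minP; apply/asboolP; exists q.
exists ((lead_coef p)^-1 *: p); have lc0 : lead_coef p != 0 by rewrite lead_coef_eq0.
have lcV0 : (lead_coef p)^-1 != 0 by rewrite invr_eq0.
split; first by rewrite monicE lead_coefZ mulVf.
  split=> [|q q_sz]; last rewrite dvdpZr //.
    rewrite size_scale // ltnNge; apply: contraL rp => le1.
    move: nz_p; rewrite (size1_polyC le1) polyC_eq0 map_polyC rootC fmorph_eq0 => ->//.
  move=> /dvdpP[r def_p]; rewrite eqp_sym (eqp_ltrans (eqp_scale _ lcV0)) eqp_sym.
  have [nzr nzq] : r != 0 /\ q != 0 by apply/andP; rewrite -negb_or -mulf_eq0 -def_p.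
  have: root (map_poly ratr r) alpha || root (map_poly ratr q) alpha.
    by rewrite -rootM -rmorphM -def_p.
  have sz_eq : size p = (size r + size q).-1 by rewrite def_p size_mul.
  have szr : (0 < size r)%N by rewrite lt0n size_poly_eq0.
  have szq : (1 < size q)%N by rewrite ltn_neqAle eq_sym q_sz lt0n size_poly_eq0.
  case/orP=> [/(minP _ nzr)|/(minP _ nzq)]; rewrite -sz_p.
    by case/(size_arith1 _ _ _ sz_eq szr szq).
  move=> le_pq; rewrite -dvdp_size_eqp; last by rewrite def_p dvdp_mull.
  by rewrite (size_arith2 _ _ _ sz_eq szr le_pq).
by rewrite linearZ rootZ // fmorph_eq0.
Qed.

Lemma zpoly_ratr (R : realType) (q : {poly int}) :
  map_poly (ratr : rat -> R[i]) (zpoly q) = zpoly q.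
Proof. by apply/polyP => i; rewrite !coef_map /= ratr_int. Qed.

(** The difference [p - q] vanishes at [alpha], hence is a multiple of the minimal polynomial over
    the rationals. *)
Lemma zpoly_conjugate (R : realType) (alpha beta : R[i]) (p q : {poly int}) :
  conjugate_of alpha beta -> (zpoly p).[alpha] = (zpoly q).[alpha] ->
  (zpoly p).[beta] = (zpoly q).[beta].
Proof.
move=> ab eqa; apply/eqP; rewrite -subr_eq0 -hornerN -hornerD -rmorphB.
rewrite -[X in X.[_]]zpoly_ratr; apply: (minimal_polynomial_root ab).
by rewrite zpoly_ratr rmorphB rootE hornerD hornerN eqa subrr.
Qed.

(** * Necessary conditions on the conjugates *)

Lemma norm_horner_bounded (R : realType) (N n : nat) (q : {poly int}) (x : R[i]) :
  bounded_coefs N q -> (size q <= n)%N ->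
  `|(zpoly q).[x]| <= N%:R * \sum_(j < n) `|x| ^+ j.
Proof.
move=> bq sz_q; rewrite (@horner_coef_wide _ n) ?(leq_trans (size_poly _ _)) //.
rewrite mulr_sumr; apply: le_trans (ler_norm_sum _ _ _) _; apply: ler_sum => j _.
rewrite normrM normrX coef_map ler_wpM2r ?exprn_ge0 //=.
by rewrite -intr_norm -[N%:R]/(N%:Z%:~R) ler_int.
Qed.

Lemma height_reducing_conjugate_ge1 (R : realType) (alpha beta : R[i]) :
  height_reducing alpha -> conjugate_of alpha beta -> 1 <= `|beta|.
Proof.
move=> /height_reducingP[N bndN] ab.
rewrite real_leNgt ?normr_real //; apply/negP => b1.
have b0 : 0 < 1 - `|beta| by rewrite subr_gt0.
(* Coefficients bounded by [N] only give values of modulus at most [N / (1 - |beta|) <= m], so the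
   integer [m + 1] is out of reach. *)
have [m mP] := archi_norm (N%:R / (1 - `|beta|)).
have [q bq /(zpoly_conjugate ab) eq_q] := bndN (m.+1%:Z)%:P.
have := norm_horner_bounded beta bq (leqnn _).
rewrite eq_q map_polyC hornerC /= normr_nat -(ler_pM2r b0).
apply/negP; rewrite -real_ltNge ?rpredM ?rpred_sum ?realn ?gtr0_real //; last first.
  by move=> i _; rewrite ger0_real ?exprn_ge0.
rewrite -mulrA.
have -> : (\sum_(j < size q) `|beta| ^+ j) * (1 - `|beta|) = 1 - `|beta| ^+ size q.
  by rewrite mulrC -opprB mulNr -subrX1 opprB.
apply: (@le_lt_trans _ _ N%:R); first by rewrite ler_piMr // gerBl exprn_ge0.
rewrite -ltr_pdivrMr //; apply: (@le_lt_trans _ _ m%:R); last by rewrite ltr_nat.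
by rewrite ger0_norm ?divr_ge0 // ?ltW in mP.
Qed.

(** An expansion [q] of the integer [N + 1] yields the annihilator [q - (N + 1)], which is nonzero
    because the constant coefficient of [q] is at most [N]. *)
Lemma height_reducing_algebraic (R : realType) (alpha : R[i]) :
  height_reducing alpha -> algebraic_number alpha.
Proof.
move=> /height_reducingP[N bndN]; have [q bq eq_q] := bndN (N.+1%:Z)%:P.
exists (zpoly (q - (N.+1%:Z)%:P)); last first.
  by rewrite zpoly_ratr rmorphB rootE hornerD hornerN eq_q subrr.
apply/eqP => /polyP/(_ 0%N)/eqP; rewrite coef_map coefB coefC coef0 intr_eq0 subr_eq0.
by move/eqP=> q0; have := bq 0%N; rewrite q0 -abszE lez_nat ltnn.
Qed.

(** Reversing the coefficients gives a polynomial whose value at [x] is [p(1/x)] times [x] to the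
    power [(size p).-1]. *)
Lemma root_reciprocal (F E : fieldType) (f : {rmorphism F -> E}) (p : {poly F}) (x : E) :
  x != 0 ->
  root (map_poly f (\poly_(i < size p) p`_(size p - i.+1))) x = root (map_poly f p) x^-1.
Proof.
move=> x0; rewrite !rootE.
rewrite (@horner_coef_wide _ (size p)) ?(leq_trans (size_poly _ _)) ?size_poly //.
rewrite (@horner_coef_wide _ (size p) (map_poly f p)) ?size_poly //.
rewrite (reindex_inj rev_ord_inj) /=.
have xn0 : x ^+ (size p).-1 != 0 by rewrite expf_neq0.
rewrite -[RHS](mulrI_eq0 _ (lregP xn0)) mulr_sumr; congr (_ == 0); apply: eq_bigr => j _.
have lejn : (j <= (size p).-1)%N by rewrite -ltnS (ltn_predK (ltn_ord j)).
rewrite !coef_map coef_poly subnSK // leq_subr subKn ?(ltnW (ltn_ord j)) // mulrCA.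
by congr (_ * _); rewrite exprVn -expfB_cond ?(negPf x0) // -subn1 -subnDA add1n.
Qed.

Lemma height_reducing_conjugates (R : realType) (alpha : R[i]) :
  height_reducing alpha ->
  (forall beta : R[i], conjugate_of alpha beta -> `|beta| = 1) \/
  (forall beta : R[i], conjugate_of alpha beta -> 1 < `|beta|).
Proof.
move=> hr; have ge1 := height_reducing_conjugate_ge1 hr.
case: (pselect (exists2 beta, conjugate_of alpha beta & `|beta| = 1)); last first.
  move=> no1; right=> beta ab; rewrite lt_neqAle ge1 // andbT eq_sym.
  by apply/eqP => b1; apply: no1; exists beta.
case=> beta [p [p_mon p_irr pa] pb] b1; left=> gamma ag.
have neq0 x : 1 <= `|x| -> x != 0 :> R[i].
  by move=> x1; rewrite -normr_gt0 (lt_le_trans ltr01).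
have pbV : root (map_poly ratr p) beta^-1.
  have conj_p : map_poly Num.conj (map_poly ratr p) = map_poly ratr p :> {poly R[i]}.
    by apply/polyP => k; rewrite !coef_map /= fmorph_rat.
  by rewrite invC_norm b1 expr1n invr1 mul1r -conj_p fmorph_root.
have b0 : beta != 0 by apply: neq0; rewrite b1.
(* As [p] is also minimal for [beta], it divides its own reciprocal. Its roots are thus closed under
   inversion, and both [gamma] and its inverse have modulus at least 1. *)
have := pbV; rewrite -root_reciprocal // => /(minimal_polynomial_dvdp (And3 p_mon p_irr pb)).
rewrite -(dvdp_map (ratr : {rmorphism rat -> R[i]})) => /dvdpP[s def_s].
have pg : root (map_poly ratr p) gamma by apply: minimal_polynomial_root ag pa.
have g1 := ge1 _ ag.
have : root (map_poly ratr p) gamma^-1.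
  by rewrite -root_reciprocal ?neq0 // def_s rootM pg orbT.
move=> pgV; have : 1 <= `|gamma^-1| by apply: ge1; exists p.
rewrite normfV invf_ge1 ?(lt_le_trans ltr01) // => g_le1.
by apply/eqP; rewrite eq_le g_le1.
Qed.

(** * Roots of unity *)

(** The value of [p] is a finite sum of terms [alpha ^+ i] and [- alpha ^+ i]; added one at a time
    at fresh positions, they leave all digits in [{-1, 0, 1}]. *)
Lemma root_of_unity_height_reducing (R : realType) (alpha : R[i]) :
  is_root_of_unity alpha -> height_reducing alpha.
Proof.
case=> n n0; rewrite unity_rootE => /eqP an1; apply/height_reducingP; exists 1%N.
(* [G c]: translation by [c] preserves the values of polynomials with coefficients in [{-1, 0, 1}].
   Such [c] are closed under addition, so signed monomials suffice. *)
pose G c := forall q, bounded_coefs 1 q ->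
  exists2 q' : {poly int}, bounded_coefs 1 q' & (zpoly q').[alpha] = (zpoly q).[alpha] + c.
have G0 : G 0 by move=> q bq; exists q; rewrite ?addr0.
have GD c d : G c -> G d -> G (c + d).
  by move=> Gc Gd q /Gc[q1 /Gd[q2 bq2 e2] e1]; exists q2; rewrite // e2 e1 addrA.
(* Since alpha ^+ n = 1, the monomial can be moved beyond the degree of q. *)
have Gmono (s : int) i : `|s| <= 1 -> G (s%:~R * alpha ^+ i).
  move=> s1 q bq; exists (q + s *: 'X^(i + n * size q)).
    move=> j; rewrite coefD coefZ coefXn; case: eqP => [->|_]; last by rewrite mulr0 addr0.
    rewrite nth_default ?add0r ?mulr1 //.
    by rewrite (leq_trans (leq_pmull _ n0)) ?leq_addl.
  rewrite rmorphD /= map_polyZ map_polyXn hornerD hornerZ hornerXn.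
  by rewrite exprD exprM an1 expr1n mulr1.
have Gnat (s : int) i k : `|s| <= 1 -> G (s%:~R * alpha ^+ i *+ k).
  by move=> s1; elim: k => // k IHk; rewrite mulrSr; apply: GD => //; apply: Gmono.
move=> p; suff Gp : G (zpoly p).[alpha].
  have [|q bq eq_q] := Gp 0; first by move=> j; rewrite coef0.
  by exists q; rewrite // eq_q rmorph0 horner0 add0r.
rewrite horner_coef; apply: (big_ind G) => // i _; rewrite coef_map /=.
case: p`_i => k; first by have := @Gnat 1 i k isT; rewrite mul1r mulr_natl.
(* [Negz k] is [-(k + 1)], hence [k.+1] copies. *)
have := @Gnat (-1) i k.+1 isT; rewrite NegzE mulN1r mulrNz.
by rewrite mulNr mulNrn mulr_natl.
Qed.

(** * Expanding algebraic numbers *)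

(** In characteristic 0 the derivative of [p] is nonzero and of smaller degree, so [p] cannot divide
    it. *)
Lemma irreducible_separable (p : {poly rat}) : irreducible_poly p -> separable_poly p.
Proof.
move=> irr_p; rewrite separable_poly.unlock /coprimep; apply: contraT => g1.
have p_n0 := irredp_neq0 irr_p.
have dp_n0 : p^`() != 0.
  rewrite -size_poly_eq0 polyorder.size_deriv.
  by case: irr_p; case: (size p) => [|[]].
have : p %| p^`() by rewrite -(eqp_dvdl _ (apply_irredp irr_p g1 (dvdp_gcdl _ _))) dvdp_gcdr.
by move/(dvdp_leq dp_n0); rewrite leqNgt lt_size_deriv.
Qed.

Lemma divX_step (P A : {poly int}) (k : nat) :
  P`_0 != 0 -> exists Dg A' Q : {poly int},
  [/\ A = Dg + 'X^k * A' + P * Q, bounded_coefs `|P`_0| Dg, (size Dg <= k)%N &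
      (size A' <= maxn (size A - k) (size P).-1)%N].
Proof.
move=> P0; elim: k => [|k [Dg [A' [Q [defA bD szD szA]]]]].
  exists 0, A, 0; rewrite expr0 mul1r mulr0 addr0 add0r; split=> //.
  - by move=> i; rewrite coef0.
  - by rewrite size_poly0.
  by rewrite subn0 leq_maxl.
(* Subtracting [q *: P] leaves the remainder [d] as constant coefficient; [d] becomes the digit at
   ['X^k], and the rest is divisible by ['X]. *)
set q := (A'`_0 %/ P`_0)%Z; set d := (A'`_0 %% P`_0)%Z.
pose B := A' - q *: P.
have B0 : B`_0 = d by rewrite coefB coefZ (divz_eq A'`_0 P`_0) -/q -/d; ring.
have defB : B = d%:P + 'X * drop_poly 1 B.
  rewrite -{1}(poly_take_drop 1 B) mulrC expr1; congr (_ + _).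
  apply/polyP => i; rewrite coef_take_poly coefC -B0.
  by case: i.
exists (Dg + d *: 'X^k), (drop_poly 1 B), (Q + q *: 'X^k); split.
- rewrite {1}defA -[A'](subrK (q *: P)) -/B {1}defB -!mul_polyC exprSr; ring.
- move=> i; rewrite coefD coefZ coefXn; case: eqP => [->|_]; last by rewrite mulr0 addr0.
  rewrite nth_default // add0r mulr1 abszE ger0_norm ?modz_ge0 //.
  by rewrite ltW // ltz_mod.
- rewrite (leq_trans (size_polyD _ _)) // geq_max (leq_trans szD) //=.
  by rewrite (leq_trans (size_scale_leq _ _)) ?size_polyXn.
(* The subtraction can raise the size to that of [P], but dropping one coefficient brings it back to
   at most [(size P).-1]. *)
rewrite size_drop_poly.
have : (size B <= maxn (size A') (size P))%N.
  rewrite (leq_trans (size_polyD _ _)) // size_polyN geq_max leq_maxl /=.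
  by rewrite (leq_trans (size_scale_leq _ _)) ?leq_maxr.
move: szA; lia.
Qed.

Lemma bounded_coefs_of_values (R : realType) (rs : seq R[i]) (B : R[i]) :
  uniq rs -> exists N, forall A : {poly int}, (size A <= size rs)%N ->
    (forall z, z \in rs -> `|(zpoly A).[z]| <= B) -> bounded_coefs N A.
Proof.
move=> uniq_rs; pose n := size rs; pose a : 'rV[R[i]]_n := \row_j rs`_j.
pose V := Vandermonde n a.
have Vu : V \in unitmx.
  rewrite unitmxE unitfE det_Vandermonde; apply/prodf_neq0 => i _.
  apply/prodf_neq0 => j ltij; rewrite !mxE subr_eq0 nth_uniq //.
  by rewrite eq_sym ltn_eqF.
(* The coefficient row is the row of values times the inverse of [V], so this sum, independent of
   [A], dominates every coefficient. *)
have [N NP] := archi_norm (\sum_i \sum_j B * `|invmx V j i|).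
exists N => A szA leB i.
case: (ltnP i n) => [lt_in|le_ni]; last by rewrite nth_default ?(leq_trans szA).
pose c : 'rV[R[i]]_n := \row_j (A`_j)%:~R.
have cV j : (c *m V) 0 j = (zpoly A).[rs`_j].
  rewrite mxE (@horner_coef_wide _ n) ?(leq_trans (size_poly _ _)) //.
  by apply: eq_bigr => k _; rewrite !mxE coef_map.
have leB' j : `|(c *m V) 0 j| <= B by rewrite cV leB ?mem_nth.
(* Nonnegativity of [B] comes from the bound at the node of index [j]. *)
have ge0 (k j : 'I_n) : 0 <= B * `|invmx V j k|.
  by rewrite mulr_ge0 // (le_trans _ (leB' j)).
rewrite -(ler_int R[i]) intr_norm; apply: le_trans NP.
rewrite [X in _ <= X]ger0_norm; last by do 2!apply: sumr_ge0 => ? _.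
rewrite (bigD1 (Ordinal lt_in)) //= ler_wpDr //.
  by do 2!apply: sumr_ge0 => ? _.
have -> : (A`_i)%:~R = c 0 (Ordinal lt_in) by rewrite mxE.
rewrite -[c](mulmxK Vu) mxE (le_trans (ler_norm_sum _ _ _)) //.
by apply: ler_sum => j _; rewrite normrM ler_wpM2r.
Qed.

(** Each of the finitely many bases needs some exponent; since the moduli exceed 1, the largest
    exponent serves them all. *)
Lemma expr_dominates (R : realType) (rs : seq R[i]) (f : R[i] -> R[i]) (k0 : nat) :
  (forall z, z \in rs -> 1 < `|z|) ->
  exists2 k, (k0 <= k)%N & forall z, z \in rs -> `|f z| <= `|z| ^+ k.
Proof.
elim: rs => [|z rs IHrs] rs1; first by exists k0.
have [|k le_k kP] := IHrs; first by move=> y yrs; rewrite rs1 // inE yrs orbT.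
have z1 : 1 < `|z| by rewrite rs1 ?mem_head.
have [l lP] := expr_unbounded (f z) z1.
exists (maxn k l); first by rewrite leq_max le_k.
move=> y; rewrite inE => /predU1P[->|yrs].
  by apply: le_trans lP _; rewrite ler_weXn2l ?leq_maxr // ltW.
apply: le_trans (kP _ yrs) _; rewrite ler_weXn2l ?leq_maxl // ltW // rs1 //.
by rewrite inE yrs orbT.
Qed.

(** Solve for the value of [A'] and divide by [z ^+ k]: the term from [A] contributes at most 1, and
    the digits a geometric sum below [N / (|z| - 1)]. *)
Lemma norm_quotient_le (R : realType) (N k : nat) (A Dg A' : {poly int}) (z : R[i]) :
  1 < `|z| -> bounded_coefs N Dg -> (size Dg <= k)%N ->
  `|(zpoly A).[z]| <= `|z| ^+ k ->
  (zpoly A).[z] = (zpoly (Dg + 'X^k * A')).[z] ->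
  `|(zpoly A').[z]| <= N%:R / (`|z| - 1) + 1.
Proof.
move=> z1 bD szD leA eqA.
have t0 : 0 < `|z| - 1 by rewrite subr_gt0.
have zk0 : 0 < `|z| ^+ k by rewrite exprn_gt0 // (lt_trans ltr01).
have eqA' : z ^+ k * (zpoly A').[z] = (zpoly A).[z] - (zpoly Dg).[z].
  by rewrite eqA rmorphD rmorphM /= map_polyXn hornerD hornerM hornerXn addrC addKr.
rewrite -(ler_pM2l zk0) -normrX -normrM eqA' (le_trans (ler_normB _ _)) //.
rewrite normrX mulrDr mulr1 addrC lerD //.
apply: le_trans (norm_horner_bounded _ bD szD) _.
rewrite mulrCA ler_wpM2l // ler_pdivlMr // mulrC -subrX1.
by rewrite gerBl.
Qed.

Lemma expanding_height_reducing (R : realType) (alpha : R[i]) :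
  algebraic_number alpha ->
  (forall beta : R[i], conjugate_of alpha beta -> 1 < `|beta|) ->
  height_reducing alpha.
Proof.
move=> /algebraic_minimal_polynomial[p mp] expanding.
have [p_mon p_irr pa] := mp.
have [P [a a0 def_p]] := rat_poly_scale p.
have a0C : (a%:~R)^-1 != 0 :> R[i] by rewrite invr_eq0 intr_eq0.
have def_pC : map_poly ratr p = (a%:~R)^-1 *: zpoly P :> {poly R[i]}.
  by rewrite {1}def_p map_polyZ zpoly_ratr fmorphV /= ratr_int.
have root_P (z : R[i]) : root (map_poly ratr p) z -> (zpoly P).[z] = 0.
  by rewrite def_pC rootZ // => /eqP.
have [rs] := closed_field_poly_normal (map_poly ratr p : {poly R[i]}).
rewrite lead_coef_map (monicP p_mon) rmorph1 scale1r => def_rs.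
have uniq_rs : uniq rs.
  by rewrite -separable_prod_XsubC -def_rs separable_map irreducible_separable.
have rs_root z : z \in rs -> root (map_poly ratr p) z.
  by rewrite def_rs root_prod_XsubC.
have rs1 z : z \in rs -> 1 < `|z| by move=> /rs_root zp; apply: expanding; exists p.
have szP : (size P).-1 = size rs.
  have := size_prod_XsubC rs id; rewrite -def_rs def_pC size_scale //.
  by rewrite size_map_inj_poly => [->||] //; apply: intr_inj.
(* Otherwise 0 would be a conjugate of [alpha], of modulus less than 1. *)
have P0 : P`_0 != 0.
  apply/negP => P00; have : 1 < `|0 : R[i]|.
    apply: expanding; exists p => //; rewrite def_pC rootZ // rootE.
    by rewrite horner_coef0 coef_map (eqP P00).
  by rewrite normr0 ltr10.
pose M := absz P`_0; pose bd (z : R[i]) : R[i] := M%:R / (`|z| - 1) + 1.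
have bd0 z : z \in rs -> 0 <= bd z.
  by move=> /rs1 z1; rewrite addr_ge0 // divr_ge0 // subr_ge0 ltW.
(* Summing the bounds over the roots gives one bound valid at each root, so [N] is fixed before [A]
   is given. *)
have [N NP] := bounded_coefs_of_values (\sum_(z <- rs) bd z) uniq_rs.
apply/height_reducingP; exists (M + N)%N => A.
(* Here [k] does two things: [size A <= k] forces [A'] to have size at most the number of roots, and
   the powers [|z| ^+ k] absorb the values of [A]. *)
have [k le_k kP] := expr_dominates (fun z => (zpoly A).[z]) (size A) rs1.
have [Dg [A' [Q [defA bD szD szA]]]] := divX_step A k P0.
have eqA (z : R[i]) : root (map_poly ratr p) z -> (zpoly A).[z] = (zpoly (Dg + 'X^k * A')).[z].
  by move=> zp; rewrite {1}defA rmorphD hornerD rmorphM hornerM (root_P _ zp) mul0r addr0.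
exists (Dg + 'X^k * A'); last by rewrite eqA.
have bA' : bounded_coefs N A'.
  apply: NP => [|z zrs].
    by move: szA; rewrite (eqP (_ : size A - k == 0)%N) ?subn_eq0 // max0n szP.
  apply: (@le_trans _ _ (bd z)).
    exact: norm_quotient_le (rs1 _ zrs) bD szD (kP _ zrs) (eqA _ (rs_root _ zrs)).
  rewrite (bigD1_seq z) //= lerDl big_seq_cond sumr_ge0 // => y /andP[yrs _].
  exact: bd0.
(* The two summands do not overlap: [Dg] occupies the degrees below [k], the shifted [A'] those from
   [k] on. *)
move=> i; rewrite coefD coefXnM PoszD; case: ltnP => [_|le_ki].
  by rewrite addr0 (le_trans (bD i)) // lerDl.
by rewrite nth_default ?(leq_trans szD) // add0r (le_trans (bA' _)) // lerDr.
Qed.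

Theorem theorem1 (R : realType) (alpha : R[i]) :
  (height_reducing alpha ->
     algebraic_number alpha /\
     ((forall beta : R[i], conjugate_of alpha beta -> `|beta| = 1) \/
      (forall beta : R[i], conjugate_of alpha beta -> 1 < `|beta|)))
  /\
  (is_root_of_unity alpha \/
     (algebraic_number alpha /\
      forall beta : R[i], conjugate_of alpha beta -> 1 < `|beta|) ->
   height_reducing alpha).
Proof.
split=> [hr|[|[alg expanding]]].
- by split; [apply: height_reducing_algebraic | apply: height_reducing_conjugates].
- exact: root_of_unity_height_reducing.
exact: expanding_height_reducing.
Qed.
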